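(* Let $X_0 \in \mathbb{R}^{n\times p}$ and $\lambda>0$ be such that for every $y\in\mathbb{R}^n$ the lasso problem $\min_{\beta_0\in\mathbb{R}^p}\frac12\|y-X_0\beta_0\|_2^2+\lambda\|\beta_0\|_1$ has a unique minimizer. If $p\ge n$, the total number of accessible lasso models is bounded above by $$2e(n+1)\left(\frac{2e\,(2p-\lfloor n/2\rfloor)}{\lceil n/2\rceil}\right)^{\lfloor n/2\rfloor}.$$
   Context: Here $n,p\ge 1$. Let $X=(X_0,-X_0)\in\mathbb{R}^{n\times 2p}$. The lasso problem is equivalently written as: minimize $\frac12\|y-X\beta\|_2^2+\lambda\sum_{j=1}^{2p}\beta_j$ over $\beta\in\mathbb{R}^{2p}$ with $\beta\ge 0$ (coordinatewise), where $\beta=(\beta_0^+,\beta_0^-)$ consists of the positive and negative parts of $\beta_0$. Uniqueness of the lasso minimizer for every $y$ gives a unique solution $\beta(y)$ of this problem for every $y$. Define $\mathrm{supp}(\beta)=\{1\le j\le 2p:\beta_j>0\}$. A signed model is a subset $S\subset\{1,\dots,2p\}$, and $A_S=\{y\in\mathbb{R}^n:\mathrm{supp}(\beta(y))=S\}$. A signed model $S$ is called accessible if $A_S\neq\emptyset$. The number $e$ is the base of the natural logarithm. *)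

(* Defs.v *)
From mathcomp Require Import all_boot all_order all_algebra.
From mathcomp Require Import all_classical all_reals all_analysis.
From mathcomp Require Import lra.

Set Implicit Arguments.
Unset Strict Implicit.
Unset Printing Implicit Defensive.

Import Order.TTheory GRing.Theory Num.Theory.
Local Open Scope classical_set_scope.
Local Open Scope ring_scope.

(* The library's norm `|v| on matrices is the sup norm, hence these two. *)
Definition norm1 (R : realType) (m : nat) (v : 'cV[R]_m) : R :=
  \sum_j `|v j 0|.

Definition norm2 (R : realType) (m : nat) (v : 'cV[R]_m) : R :=
  Num.sqrt (\sum_j v j 0 ^+ 2).

Definition minimizer (R : realType) (T : Type) (D : set T) (f : T -> R)
    (x : T) : Prop :=
  D x /\ forall z, D z -> f x <= f z.

Definition lasso (R : realType) (n p : nat) (X0 : 'M[R]_(n, p)) (lambda : R)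
    (y : 'cV[R]_n) (b : 'cV[R]_p) : R :=
  2^-1 * norm2 (y - X0 *m b) ^+ 2 + lambda * norm1 b.

Definition signed_design (R : realType) (n p : nat) (X0 : 'M[R]_(n, p)) :
    'M[R]_(n, p + p) :=
  row_mx X0 (- X0).

Definition nneg_vec (R : realType) (m : nat) : set 'cV[R]_m :=
  [set b | forall j, 0 <= b j 0].

Definition signed_lasso (R : realType) (n p : nat) (X0 : 'M[R]_(n, p))
    (lambda : R) (y : 'cV[R]_n) (b : 'cV[R]_(p + p)) : R :=
  2^-1 * norm2 (y - signed_design X0 *m b) ^+ 2 + lambda * \sum_j b j 0.

(* The default value 0 is taken only if there is no minimizer;
   signed_lasso_unique below shows that the solution exists and is unique
   as soon as the lasso minimizer is. *)
Definition signed_sol (R : realType) (n p : nat) (X0 : 'M[R]_(n, p))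
    (lambda : R) (y : 'cV[R]_n) : 'cV[R]_(p + p) :=
  xget 0 [set b | minimizer (@nneg_vec R (p + p))
                            (signed_lasso X0 lambda y) b].

Definition supp (R : realType) (m : nat) (b : 'cV[R]_m) : {set 'I_m} :=
  [set j | 0 < b j 0]%SET.

Definition model_region (R : realType) (n p : nat) (X0 : 'M[R]_(n, p))
    (lambda : R) (S : {set 'I_(p + p)}) : set 'cV[R]_n :=
  [set y | supp (signed_sol X0 lambda y) = S].

Definition accessible (R : realType) (n p : nat) (X0 : 'M[R]_(n, p))
    (lambda : R) (S : {set 'I_(p + p)}) : Prop :=
  model_region X0 lambda S !=set0.

Definition accessible_models (R : realType) (n p : nat) (X0 : 'M[R]_(n, p))
    (lambda : R) : {set {set 'I_(p + p)}} :=
  [set S | `[< accessible X0 lambda S >]]%SET.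

Definition pos_neg_parts (R : realType) (p : nat) (b : 'cV[R]_p) :
    'cV[R]_(p + p) :=
  col_mx (\col_j Num.max (b j 0) 0) (\col_j Num.max (- b j 0) 0).

Lemma signed_lasso_parts (R : realType) (n p : nat) (X0 : 'M[R]_(n, p))
    (lambda : R) (y : 'cV[R]_n) (b : 'cV[R]_p) :
  signed_lasso X0 lambda y (pos_neg_parts b) = lasso X0 lambda y b.
Proof.
rewrite /signed_lasso /lasso /signed_design mul_row_col mulNmx -mulmxBr.
have -> : (\col_j Num.max (b j 0) 0) - (\col_j Num.max (- b j 0) 0) = b.
  apply/matrixP => j k; rewrite !mxE (ord1 k) /Num.max.
  by do 2 case: ifP; lra.
congr (_ + lambda * _); rewrite big_split_ord -[LHS]big_split.
apply: eq_bigr => j _ /=; rewrite /pos_neg_parts col_mxEu col_mxEd !mxE.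
rewrite /Num.max.
by case: (ger0P (b j 0)) => hb; repeat case: ifP; lra.
Qed.

Lemma signed_lasso_unique (R : realType) (n p : nat) (X0 : 'M[R]_(n, p))
    (lambda : R) (y : 'cV[R]_n) :
  0 < lambda ->
  (exists! b0, minimizer setT (lasso X0 lambda y) b0) ->
  exists! b, minimizer (@nneg_vec R (p + p)) (signed_lasso X0 lambda y) b.
Proof.
move=> l0 [b0 [[_ b0min] b0uniq]].
have ge_lasso (u d : 'cV[R]_p) : nneg_vec (col_mx u d) ->
    lasso X0 lambda y (u - d) <= signed_lasso X0 lambda y (col_mx u d)
    ?= iff [forall j, `|u j 0 - d j 0| == u j 0 + d j 0].
  move=> ud0; rewrite /signed_lasso /lasso /signed_design mul_row_col mulNmx.
  rewrite -mulmxBr.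
  have -> : \sum_j col_mx u d j 0 = \sum_j (u j 0 + d j 0).
    rewrite big_split_ord -[LHS]big_split; apply: eq_bigr => j _ /=.
    by rewrite col_mxEu col_mxEd.
  rewrite /norm1; under eq_bigr do rewrite !mxE.
  have h : \sum_j `|u j 0 - d j 0| <= \sum_j (u j 0 + d j 0)
      ?= iff [forall j, `|u j 0 - d j 0| == u j 0 + d j 0].
    apply: leif_sum => j _; apply/leifP.
    have := ud0 (lshift p j); have := ud0 (rshift p j).
    rewrite col_mxEu col_mxEd => d0 u0.
    case: ifP => [//|/negbT ne]; rewrite lt_neqAle ne ler_norml /=.
    by apply/andP; split; lra.
  by split; rewrite ?lerD2l ?ler_pM2l ?h //
    (inj_eq (addrI _)) (inj_eq (mulfI (lt0r_neq0 l0))) h.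
have parts0 b : nneg_vec (pos_neg_parts b).
  move=> j; rewrite /pos_neg_parts mxE.
  by case: (fintype.split j) => k; rewrite mxE le_max lexx orbT.
exists (pos_neg_parts b0); split.
  split=> // z z0; rewrite signed_lasso_parts -[z]vsubmxK.
  rewrite -[z]vsubmxK in z0.
  exact: le_trans (b0min _ I) (ge_lasso _ _ z0).1.
move=> z; rewrite -[z]vsubmxK; move: (usubmx z) (dsubmx z) => u d [z0 zmin].
have [le_ud eq_ud] := ge_lasso _ _ z0.
have b0E : b0 = u - d.
  apply: b0uniq; split=> // w _; apply: le_trans le_ud _.
  by rewrite -signed_lasso_parts; exact: zmin.
have /forallP tight : [forall j, `|u j 0 - d j 0| == u j 0 + d j 0].
  rewrite -eq_ud eq_le le_ud /= -b0E -(signed_lasso_parts _ _ _ b0).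
  exact: zmin.
rewrite /pos_neg_parts b0E; congr col_mx; apply/matrixP => j k;
  rewrite (ord1 k) !mxE /Num.max; move/eqP: (tight j);
  case: (ger0P (u j 0 - d j 0)) => hj; repeat case: ifP; lra.
Qed.

(* Main.v *)
(* By the KKT conditions, every accessible S is contained in the active set of
   a point of the polyhedron P = {u : X^T u <= lambda}, with X = (X0, -X0), and
   uniqueness of the lasso makes the columns of X active at a point of P
   linearly independent: P is simple, and S is one of its faces. Faces are
   counted as in Seidel's proof of the asymptotic upper bound theorem. For a
   generic linear functional c every face has a unique lowest vertex, and the
   faces with lowest vertex v form a Boolean interval [D v, E v], where E v is
   the active set of v and D v collects the active constraints on which c has a
   positive coordinate; the same holds for -c, with U v = E v \ D v in place of
   D v. As |E v| <= n, one of D v and U v has size at most floor (n / 2), so up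
   to a factor 2 * 2 ^ ceil (n / 2) it suffices to count faces S with
   |S| <= floor (n / 2). A face never contains both signs of a column, so there
   are at most sum_(i <= floor (n / 2)) 2 ^ i * C(p, i) of these; the gain over
   C(2 p, i) is what makes the constant 2 e attainable. *)
Require Import Defs.
From mathcomp Require Import all_boot all_order all_algebra.
From mathcomp Require Import all_classical all_reals all_analysis.
From mathcomp Require Import lra ring zify fintype finset.

Set Implicit Arguments.
Unset Strict Implicit.
Unset Printing Implicit Defensive.

Import Order.TTheory GRing.Theory Num.Theory.

Local Open Scope ring_scope.

(** * Counting with disjoint Boolean intervals *)

(** Double counting of the pairs [x \in K i]: disjointness leaves at most one [i] for each [x]. *)
Lemma leq_sum_trivIset (I T : finType) (V : {set I}) (K : I -> {set T})
    (G : {set T}) :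
  (forall i, i \in V -> K i \subset G) ->
  (forall i j x, i \in V -> j \in V -> x \in K i -> x \in K j -> i = j) ->
  (\sum_(i in V) #|K i| <= #|G|)%N.
Proof.
move=> KG Kinj.
under eq_bigr do rewrite -sum1_card.
rewrite (exchange_big_dep (mem G)) /=; last first.
  by move=> i x iV /(subsetP (KG i iV)).
rewrite -[leqRHS]sum1_card; apply: leq_sum => x xG.
rewrite sum1_card; case: (pickP [pred i in V | x \in K i]) => [i /= /andP[iV xi]|none].
  rewrite -(cards1 i); apply: subset_leq_card; apply/subsetP => j.
  by case/andP => jV xj; rewrite inE (Kinj j i x).
by rewrite eq_card0 // => i; exact: none.
Qed.

Lemma card_bigcup_le (I T : finType) (P : pred I) (K : I -> {set T}) :
  (#|\bigcup_(i | P i) K i| <= \sum_(i | P i) #|K i|)%N.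
Proof.
elim/big_rec2: _ => [|i k B _ le]; rewrite ?cards0 //.
by apply: leq_trans (leq_card_setU _ _) _; rewrite leq_add2l.
Qed.

(** For a subset [K] of [U] with [k] elements, the sets [D :|: L] with [L \subset K] are [2 ^ k]
    distinct small members of the interval. The largest [k] that respects the size limit satisfies
    [#|U| <= uphalf n + k], because [#|D| + #|U| <= n]. *)
Lemma card_interval_small (T : finType) (D U E : {set T}) (n : nat) :
  [disjoint D & U] -> D :|: U = E -> (#|E| <= n)%N -> (#|D| <= #|U|)%N ->
  (2 ^ #|U| <= 2 ^ uphalf n *
     #|[set S : {set T} | [&& D \subset S, S \subset E & #|S| <= n./2]%N]%SET|)%N.
Proof.
move=> DU <- En leDU; have cardE : #|D :|: U| = (#|D| + #|U|)%N.
  by rewrite cardsU disjoint_setI0 // cards0 subn0.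
(* The truncated subtraction is exact: [#|D| <= #|U|] gives [2 * #|D| <= n]. *)
rewrite cardE in En; pose k := minn (n./2 - #|D|) #|U|.
have nE : (n = uphalf n + n./2)%N by lia.
have [K KU Kk] : exists2 K : {set T}, K \subset U & #|K| = k.
  have : (0 < #|[set K : {set T} | K \subset U & #|K| == k]%SET|)%N.
    by rewrite cards_draws bin_gt0 geq_minr.
  by case/card_gt0P => K; rewrite inE => /andP[? /eqP]; exists K.
apply: (@leq_trans (2 ^ uphalf n * 2 ^ k)).
  by rewrite -expnD leq_exp2l // /k; lia.
rewrite leq_mul2l expn_eq0 /= -Kk -card_powerset.
rewrite -(card_in_imset (f := fun L : {set T} => D :|: L)).
  apply: subset_leq_card; apply/subsetP => S /imsetP[L].
  rewrite powersetE => LK ->; rewrite inE subsetUl setUS ?(subset_trans LK) //=.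
  have := subset_leq_card LK; have := (leq_card_setU D L).1; rewrite Kk /k; lia.
move=> L M; rewrite !powersetE => LK MK /setP LM.
have DL (N : {set T}) : N \subset K -> N = (D :|: N) :\: D.
  move=> NK; rewrite setDUl setDv set0U; apply/esym/setDidPl.
  rewrite disjoint_sym; apply: disjointWr DU.
  exact: subset_trans NK KU.
by rewrite (DL L) // (DL M) //; congr (_ :\: _); apply/setP.
Qed.

(* The intervals [D E, E] cover F, so |F| is at most the sum of the 2 ^ |U E|.
   The smaller of D E and U E has at most n./2 elements, so the interval from it
   to E has at least 2 ^ max(|D E|, |U E|) / 2 ^ uphalf n members of size at
   most n./2, and each such member is counted at most once per side. *)
Lemma card_two_sided_partition (T : finType) (F V : {set {set T}})
    (D U : {set T} -> {set T}) (n : nat) :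
  (forall E, E \in V -> [disjoint D E & U E]) ->
  (forall E, E \in V -> D E :|: U E = E) ->
  (forall E, E \in V -> (#|E| <= n)%N) ->
  (forall E S : {set T}, E \in V -> S \subset E -> S \in F) ->
  (forall S, S \in F -> exists2 E, E \in V & (D E \subset S) && (S \subset E)) ->
  (forall E E' S : {set T}, E \in V -> E' \in V -> D E \subset S -> S \subset E ->
     D E' \subset S -> S \subset E' -> E = E') ->
  (forall E E' S : {set T}, E \in V -> E' \in V -> U E \subset S -> S \subset E ->
     U E' \subset S -> S \subset E' -> E = E') ->
  (#|F| <= 2 ^ (uphalf n).+1 * #|[set S in F | #|S| <= n./2]%N|)%N.
Proof.
move=> dj DUE En VF FV Dinj Uinj.
pose I0 (C : {set T} -> {set T}) E :=
  [set S : {set T} | [&& C E \subset S, S \subset E & #|S| <= n./2]%N]%SET.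
have small (C : {set T} -> {set T}) :
    (forall E E' S : {set T}, E \in V -> E' \in V -> C E \subset S ->
     S \subset E -> C E' \subset S -> S \subset E' -> E = E') ->
    (\sum_(E in V) #|I0 C E| <= #|[set S in F | #|S| <= n./2]%N|)%N.
  move=> Cinj; apply: leq_sum_trivIset => [E EV|E E' S EV E'V].
    apply/subsetP => S; rewrite !inE => /and3P[_ SE ->].
    by rewrite (VF E).
  by rewrite !inE => /and3P[? ? _] /and3P[? ? _]; apply: (Cinj E E' S).
have cover : (#|F| <= \sum_(E in V) 2 ^ #|U E|)%N.
  apply: (@leq_trans #|\bigcup_(E in V) [set D E :|: L | L in powerset (U E)]%SET|).
    apply: subset_leq_card; apply/subsetP => S /FV[E EV /andP[DS SE]].
    apply/bigcupP; exists E => //; apply/imsetP; exists (S :&: U E).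
      by rewrite powersetE subsetIr.
    by rewrite setUIr DUE // (setUidPr DS) (setIidPl SE).
  apply: leq_trans (card_bigcup_le _ _) _.
  by apply: leq_sum => E _; rewrite -card_powerset leq_imset_card.
apply: leq_trans cover _; rewrite expnS mulnAC mulnC mul2n -addnn.
apply: leq_trans (leq_mul (leqnn _) (leq_add (small D Dinj) (small U Uinj))).
rewrite -big_split big_distrr /=; apply: leq_sum => E EV.
rewrite mulnDr; have [le|/ltnW le] := leqP #|D E| #|U E|.
  apply: leq_trans (leq_addr _ _).
  exact: card_interval_small (dj E EV) (DUE E EV) (En E EV) le.
apply: leq_trans (leq_addl _ _).
apply: (@leq_trans (2 ^ #|D E|)); first by rewrite leq_exp2l.
apply: (card_interval_small _ _ (En E EV) le); last by rewrite setUC DUE.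
by rewrite disjoint_sym dj.
Qed.

(** * Sets without antipodal pairs, and numerical estimates *)

(** Such a set is determined by the indices it uses, as many as its elements, and by the subset of
    them taken with positive sign. *)
Lemma card_antipode_free (p a : nat) (G : {set {set 'I_(p + p)}}) :
  (forall S, S \in G -> (#|S| <= a)%N) ->
  (forall S, S \in G -> forall j : 'I_p,
     ~~ ((lshift p j \in S) && (rshift p j \in S))) ->
  (#|G| <= \sum_(i < a.+1) 2 ^ i * 'C(p, i))%N.
Proof.
move=> Ga Gfree.
pose pos (S : {set 'I_(p + p)}) := @lshift p p @^-1: S.
pose neg (S : {set 'I_(p + p)}) := @rshift p p @^-1: S.
pose enc S := (pos S :|: neg S, pos S).
have cardS S : S \in G -> #|pos S :|: neg S| = #|S|.
  move=> SG; have dis : [disjoint pos S & neg S].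
    rewrite -setI_eq0; apply/eqP/setP => j; rewrite !inE.
    exact/negbTE/Gfree.
  rewrite cardsU disjoint_setI0 // cards0 subn0.
  rewrite -[in RHS]sum1_card big_split_ord /= !sum1_card.
  by congr addn; apply: eq_card => j; rewrite !inE.
have enc_inj : {in G &, injective enc}.
  move=> S S' SG S'G [eU eP]; apply/setP => j.
  have eN : neg S = neg S'.
    have negE Z : Z \in G -> neg Z = (pos Z :|: neg Z) :\: pos Z.
      move=> ZG; rewrite setDUl setDv set0U; apply/esym/setDidPl.
      rewrite disjoint_sym -setI_eq0; apply/eqP/setP => i; rewrite !inE.
      exact/negbTE/Gfree.
    by rewrite negE // eU eP -negE.
  rewrite -(splitK j); case: (fintype.split j) => k /=.
    by have /setP/(_ k) := eP; rewrite !inE.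
  by have /setP/(_ k) := eN; rewrite !inE.
rewrite -(card_in_imset enc_inj).
pose tgt (i : 'I_a.+1) := [set q : {set 'I_p} * {set 'I_p} |
  (q.2 \subset q.1) && (#|q.1| == i)]%SET.
have tgtC i : #|tgt i| = (2 ^ i * 'C(p, i))%N.
  rewrite -[p in 'C(p, _)]card_ord -card_draws -sum1_card.
  rewrite (eq_bigl (fun q : {set 'I_p} * {set 'I_p} =>
     (#|q.1| == i) && (q.2 \subset q.1))); last first.
    by move=> q; rewrite inE andbC.
  rewrite -(pair_big_dep (fun T : {set 'I_p} => #|T| == i)
     (fun T L : {set 'I_p} => L \subset T) (fun _ _ => 1%N)) /=.
  rewrite (eq_bigr (fun _ => 2 ^ i)%N) => [|T /eqP <-]; last first.
    by rewrite sum1_card -card_powerset; apply: eq_card => L; rewrite powersetE.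
  by rewrite sum_nat_const mulnC; congr muln; apply: eq_card => T; rewrite !inE.
under eq_bigr do rewrite -tgtC.
apply: (@leq_trans #|\bigcup_i tgt i|).
  apply: subset_leq_card; apply/subsetP => q /imsetP[S SG ->].
  have ltS : (#|S| < a.+1)%N by rewrite ltnS Ga.
  by apply/bigcupP; exists (Ordinal ltS); rewrite // inE /= subsetUl cardS //=.
exact: card_bigcup_le.
Qed.

(** Up to the middle of the binomial row each term is at least twice the preceding one, so the last
    term dominates as in a geometric sum. *)
Lemma sum_exp2_bin_le (p a : nat) : (2 * a <= p)%N ->
  (\sum_(i < a.+1) 2 ^ i * 'C(p, i) <= 2 * (2 ^ a * 'C(p, a)))%N.
Proof.
elim: a => [|a IH] ap; first by rewrite big_ord_recr big_ord0 /= bin0.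
rewrite big_ord_recr /=.
have ge : ('C(p, a) <= 'C(p, a.+1))%N.
  rewrite -(@leq_pmul2l a.+1) // mul_bin_left leq_mul2r; lia.
have := IH ltac:(lia); rewrite expnS.
have := leq_mul (leqnn (2 ^ a)) ge.
move: (\sum_(i < a.+1) _) => s; nia.
Qed.

(* Pairing the factors [2 p - 2 i] and [2 p - 2 (a - 1 - i)], whose mean is
   [2 p - a + 1]. *)
Lemma exp2_ffact_le (p a : nat) : (a <= p)%N ->
  (2 ^ a * p ^_ a <= (2 * p - a).+1 ^ a)%N.
Proof.
move=> ap; rewrite -leq_sqr.
have -> : (2 ^ a * p ^_ a = \prod_(i < a) (2 * (p - i)))%N.
  by rewrite big_split /= prod_nat_const card_ord ffact_prod.
have -> : (((2 * p - a).+1 ^ a) ^ 2 = \prod_(i < a) (2 * p - a).+1 ^ 2)%N.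
  by rewrite prod_nat_const card_ord -!expnM (mulnC a).
rewrite -mulnn {2}(reindex_inj rev_ord_inj) /= -big_split /=.
apply: leq_prod => i _; have := ltn_ord i; move: (nat_of_ord i) => {}i ia.
have [x px] : exists x, p = (a + x)%N by exists (p - a)%N; lia.
have [y ay] : exists y, a = (i + y).+1 by exists (a - i.+1)%N; lia.
subst p a.
have -> : ((i + y).+1 + x - ((i + y).+1 - i.+1) = i + x + 1)%N by lia.
have -> : ((i + y).+1 + x - i = y + x + 1)%N by lia.
have -> : ((2 * ((i + y).+1 + x) - (i + y).+1).+1 = (i + x + 1) + (y + x + 1))%N by lia.
move: (i + x + 1)%N (y + x + 1)%N => s t.
have -> : (2 * t * (2 * s) = 4 * (s * t))%N by ring.
by apply: leq_trans (nat_AGM2 s t).1; rewrite mulnA.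
Qed.

(** By induction: passing from [a] to [a.+1] multiplies the left side by
    [a.+1 * (1 + 1 / a.+1) ^ a.+1], and the power is at most [e]. The base [a.+1] covers [uphalf n]
    when [n] is odd and [a = n./2]. *)
Lemma expS_le_fact_expR (R : realType) (a : nat) :
  a.+1%:R ^+ a <= a`!%:R * expR 1 ^+ a :> R.
Proof.
elim: a => [|a IH]; first by rewrite !expr0 fact0 mulr1.
have -> : a.+2%:R ^+ a.+1 = a.+1%:R ^+ a.+1 * (1 + a.+1%:R^-1) ^+ a.+1 :> R.
  rewrite -exprMn mulrDr mulr1 divff ?pnatr_eq0 //.
  by rewrite [in LHS]mulrSr.
have le1 : (1 + a.+1%:R^-1) ^+ a.+1 <= expR 1 :> R.
  apply: (@le_trans _ _ (expR a.+1%:R^-1 ^+ a.+1)).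
    by rewrite lerXn2r ?nnegrE ?expR_ge0 ?expR_ge1Dx // addr_ge0.
  by rewrite -expRM_natl divff // pnatr_eq0.
rewrite factS natrM exprS [in leRHS]exprSr -!mulrA ler_wpM2l //.
by rewrite mulrA ler_pM // exprn_ge0.
Qed.

(** With [N = 2 p - a], the pairing bound gives [(N + 1) ^ a / a!]. One factor [e] pays for
    replacing [N + 1] by [N], since [a <= N]; the factors [e ^ a] replace [a!] by [b ^ a]. *)
Lemma exp2_bin_le_expR (R : realType) (p a b : nat) :
  (0 < p)%N -> (2 * a <= p)%N -> (0 < b)%N -> (b <= a.+1)%N ->
  (2 ^ a * 'C(p, a))%:R <=
    expR 1 * (expR 1 * (2 * p%:R - a%:R) / b%:R) ^+ a :> R.
Proof.
move=> p0 ap b0 ba.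
have -> : 2 * p%:R - a%:R = (2 * p - a)%N%:R :> R by rewrite natrB ?natrM //; lia.
set N := (2 * p - a)%N; have N0 : 0 < N%:R :> R by rewrite ltr0n /N; lia.
have step1 : (2 ^ a * 'C(p, a))%:R * a`!%:R <= N.+1%:R ^+ a :> R.
  rewrite -natrM -natrX ler_nat -mulnA bin_ffact exp2_ffact_le //; lia.
have step2 : N.+1%:R ^+ a <= expR 1 * N%:R ^+ a :> R.
  apply: (@le_trans _ _ ((expR N%:R^-1 * N%:R) ^+ a)).
    rewrite lerXn2r ?nnegrE ?mulr_ge0 ?expR_ge0 //.
    apply: le_trans (ler_wpM2r (ltW N0) (expR_ge1Dx _)).
    by rewrite mulrDl mul1r mulVf ?gt_eqF // -natr1.
  rewrite exprMn ler_wpM2r ?exprn_ge0 // -expRM_natl ler_expR.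
  by rewrite ler_pdivrMr // mul1r ler_nat /N; lia.
have step3 : b%:R ^+ a <= a`!%:R * expR 1 ^+ a :> R.
  apply: le_trans (expS_le_fact_expR R a).
  by rewrite lerXn2r ?nnegrE // ler_nat.
rewrite expr_div_n mulrA ler_pdivlMr ?exprn_gt0 ?ltr0n //.
apply: (le_trans (ler_wpM2l (ler0n _ _) step3)).
rewrite mulrA exprMn mulrCA mulrC ler_wpM2l ?exprn_ge0 ?expR_ge0 //.
exact: le_trans step1 step2.
Qed.

Lemma lasso_numeric_bound (R : realType) (n p : nat) :
  (1 <= n)%N -> (n <= p)%N ->
  (2 ^ (uphalf n).+1 * \sum_(i < n./2.+1) 2 ^ i * 'C(p, i))%:R <=
    2 * expR 1 * (n%:R + 1) *
    (2 * expR 1 * (2 * p%:R - (n./2)%:R) / (uphalf n)%:R) ^+ n./2 :> R.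
Proof.
move=> n1 np; have := expR_ge1Dx (1 : R).
(* The estimate [pow_le] below fails for [n = 1] (8 against 4); there the claim reduces to
   [4 <= 4 e]. *)
have [->|n2] := eqVneq n 1%N.
  by rewrite big_ord_recr big_ord0 /= expr0 bin0; lra.
move=> e2; set a := n./2; set b := uphalf n.
have ap : (2 * a <= p)%N by rewrite /a; lia.
have bin_le : (2 ^ a * 'C(p, a))%:R <=
    expR 1 * (expR 1 * (2 * p%:R - a%:R) / b%:R) ^+ a :> R.
  by apply: exp2_bin_le_expR; rewrite /a /b; lia.
have -> : 2 * expR 1 * (2 * p%:R - a%:R) / b%:R =
    2 * (expR 1 * (2 * p%:R - a%:R) / b%:R) :> R by rewrite !mulrA.
move: bin_le; set Y := _ / _ => bin_le.
have Y0 : 0 <= Y.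
  rewrite /Y divr_ge0 // mulr_ge0 ?expR_ge0 // subr_ge0 -natrM ler_nat; lia.
(* On the left, [2 ^ b.+1] comes from the face count and 2 from the geometric sum; on the right,
   [2 ^ a] is the 2 inside the power of the target. *)
have pow_le : (2 ^ b.+1 * 2 <= 2 * n.+1 * 2 ^ a)%N.
  have := uphalf_half n; rewrite -/a -/b; case: (boolP (odd n)) => odd_n bE.
    rewrite bE add1n !expnS; have : (0 < 2 ^ a)%N by rewrite expn_gt0.
    have : (3 <= n)%N by lia.
    clear; move: (2 ^ a)%N => x; nia.
  rewrite bE add0n !expnS; nia.
apply: (@le_trans _ _ ((2 ^ b.+1 * 2)%:R * (2 ^ a * 'C(p, a))%:R)).
  by rewrite -natrM ler_nat -mulnA leq_mul2l sum_exp2_bin_le // orbT.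
apply: (le_trans (ler_wpM2l (ler0n _ _) bin_le)).
rewrite [leRHS](_ : _ = (2 * n.+1 * 2 ^ a)%:R * (expR 1 * Y ^+ a)).
  by rewrite ler_wpM2r ?mulr_ge0 ?expR_ge0 ?exprn_ge0 // ler_nat.
by rewrite exprMn !natrM natrX -natr1; ring.
Qed.

(** * Vertices and faces of a simple polyhedron *)

Definition in_polyhedron (R : realType) (m n : nat) (A : 'M[R]_(m, n)) (l : R)
    (u : 'cV[R]_n) : Prop := forall i, (A *m u) i 0 <= l.

Definition tight (R : realType) (m n : nat) (A : 'M[R]_(m, n)) (l : R)
    (u : 'cV[R]_n) : {set 'I_m} := [set i | (A *m u) i 0 == l]%SET.

(* A vertex modulo the lineality space ker A. *)
Definition is_vertex (R : realType) (m n : nat) (A : 'M[R]_(m, n)) (l : R)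
    (v : 'cV[R]_n) : Prop :=
  in_polyhedron A l v /\
  forall d : 'cV_n, (forall i, i \in tight A l v -> (A *m d) i 0 = 0) -> A *m d = 0.

(** Stated through relations supported on [E], so that a relation can serve directly as a
    perturbation of a lasso solution. *)
Definition rows_independent (R : realType) (m n : nat) (A : 'M[R]_(m, n))
    (E : {set 'I_m}) : Prop :=
  forall w : 'rV[R]_m, (forall i, i \notin E -> w 0 i = 0) -> w *m A = 0 -> w = 0.

(** A right inverse of the rows in [E], spread over all [m] columns. If [E] is the active set of a
    vertex, the columns of [B] in [E] are minus the edge directions there, and the signs of
    [c *m A *m B] tell which edges descend. *)
Lemma rows_independent_dual (R : realType) (m n : nat) (A : 'M[R]_(m, n))
    (E : {set 'I_m}) : rows_independent A E ->
  exists B : 'M[R]_(n, m),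
    forall i j, i \in E -> j \in E -> (A *m B) i j = (i == j)%:R.
Proof.
move=> indE; pose f (k : 'I_#|E|) := enum_val k.
have free : row_free (rowsub f A).
  apply: inj_row_free => v vA.
  pose w : 'rV[R]_m := \row_i \sum_(k | f k == i) v 0 k.
  have w0 : w = 0.
    apply: indE => [i iE|].
      rewrite mxE big_pred0 // => k; apply: contraNF iE => /eqP <-.
      exact: enum_valP.
    apply/rowP => j; rewrite -vA !mxE [in RHS](partition_big f predT) //=.
    apply: eq_bigr => i _; rewrite !mxE big_distrl /=.
    by apply: eq_bigr => k /eqP <-; rewrite !mxE.
  apply/rowP => k; have /rowP/(_ (f k)) := w0; rewrite !mxE.
  by rewrite (big_pred1 k) // => k' /=; rewrite (inj_eq enum_val_inj).
have [C dualC] := row_freeP free.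
exists (\matrix_(a, i) \sum_(k | f k == i) C a k) => i j iE jE.
have fE x (xE : x \in E) : f (enum_rank_in xE x) = x.
  by rewrite /f enum_rankK_in.
have := congr1 (fun M : 'M[R]_#|E| => M (enum_rank_in iE i) (enum_rank_in jE j)) dualC.
rewrite !mxE => H.
rewrite -[X in (X == j)](fE _ iE) -[X in (_ == X)](fE _ jE).
rewrite (inj_eq enum_val_inj) -H; apply: eq_bigr => a _; rewrite !mxE fE.
rewrite (big_pred1 (enum_rank_in jE j)) // => k /=.
by rewrite -[X in _ == X](fE _ jE) (inj_eq enum_val_inj).
Qed.

Lemma rows_independent_card (R : realType) (m n : nat) (A : 'M[R]_(m, n))
    (E : {set 'I_m}) : rows_independent A E -> (#|E| <= n)%N.
Proof.
move=> /rows_independent_dual[B AB].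
have <- : \rank (rowsub (fun k : 'I_#|E| => enum_val k) A) = #|E|.
  apply/eqP; apply/row_freeP.
  exists (colsub (fun k : 'I_#|E| => enum_val k) B).
  apply/matrixP => i j; rewrite mxE.
  under eq_bigr do rewrite !mxE.
  have := AB _ _ (enum_valP i) (enum_valP j); rewrite mxE => ->.
  by rewrite (inj_eq enum_val_inj) mxE.
exact: rank_leq_col.
Qed.

(** Take [c] on the moment curve: each [c *m g i] is the value at [t] of a nonzero polynomial, and
    some [t] avoids the roots of their product. *)
Lemma generic_functional (R : realType) (m : nat) (I : finType) (P : pred I)
    (g : I -> 'cV[R]_m) : (forall i, P i -> g i != 0) ->
  exists c : 'rV_m, forall i, P i -> (c *m g i) 0 0 != 0.
Proof.
move=> g0; pose q i := rVpoly (g i)^T.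
have q0 i : P i -> q i != 0.
  move=> Pi; apply: contraNneq (g0 i Pi) => qi0.
  rewrite -[g i]trmxK -[(g i)^T]rVpolyK -/(q i) qi0.
  by apply/eqP/matrixP => a b; rewrite !mxE coef0.
pose Q := \prod_(i | P i) q i.
have Q0 : Q != 0 by apply/prodf_neq0.
have [t Qt] : exists t : R, ~~ root Q t.
  apply: contrapT => none.
  (* A nonzero [Q] has fewer than [size Q] roots, so one of these distinct naturals is not a
     root. *)
  have := max_poly_roots (rs := [seq k%:R | k <- iota 0 (size Q)]) Q0.
  rewrite size_map size_iota ltnn => H; apply/notF/H; first last.
    by rewrite map_inj_uniq ?iota_uniq //; by move=> x y /eqP; rewrite eqr_nat => /eqP.
  apply/allP => t _; apply: contrapT => nr; apply: none; exists t; exact/negP.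
exists (\row_k t ^+ k) => i Pi.
have -> : (\row_k t ^+ k *m g i) 0 0 = (q i).[t].
  rewrite mxE (horner_coef_wide (n := m)); last first.
    by rewrite /q /rVpoly size_poly.
  by apply: eq_bigr => k _; rewrite !mxE coef_rVpoly_ord mxE mulrC.
apply: contraNneq Qt => qt0; rewrite /root /Q horner_prod (bigD1 i) //=.
by rewrite qt0 mul0r.
Qed.

Lemma polyhedron_small_step (R : realType) (m n : nat) (A : 'M[R]_(m, n))
    (l : R) (u d : 'cV[R]_n) : in_polyhedron A l u ->
  (forall i, i \in tight A l u -> (A *m d) i 0 <= 0) ->
  exists2 t : R, 0 < t & in_polyhedron A l (u + t *: d).
Proof.
move=> uP du; pose s i := l - (A *m u) i 0; pose q i := (A *m d) i 0.
(* [K] exceeds every ratio of speed to slack, so a step of length [K^-1] uses up no slack. Tight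
   rows add 0, the value of division by 0. *)
pose K := 1 + \sum_i `|q i| / s i.
have term0 i : 0 <= `|q i| / s i by rewrite divr_ge0 // subr_ge0 uP.
have K0 : 0 < K by rewrite ltr_pwDl // sumr_ge0.
exists K^-1; first by rewrite invr_gt0.
move=> i; rewrite mulmxDr -scalemxAr mxE [X in _ + X]mxE.
rewrite addrC -lerBrDr -/(s i) -/(q i).
have [it|it] := boolP (i \in tight A l u).
  apply: (@le_trans _ _ 0); last by rewrite subr_ge0.
  by apply: mulr_ge0_le0; [rewrite invr_ge0 ltW | exact: du].
have s0 : 0 < s i.
  by rewrite subr_gt0 lt_neqAle uP andbT; move: it; rewrite inE.
rewrite mulrC ler_pdivrMr // -ler_pdivrMl // mulrC.
apply: (@le_trans _ _ (`|q i| / s i)).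
  by rewrite ler_wpM2r ?ler_norm // invr_ge0 ltW.
rewrite /K (bigD1 i) //= addrCA lerDl addr_ge0 // sumr_ge0 //.
Qed.

Lemma polyhedron_ratio_test (R : realType) (m n : nat) (A : 'M[R]_(m, n))
    (l : R) (u d : 'cV[R]_n) (j : 'I_m) : in_polyhedron A l u ->
  (forall i, i \in tight A l u -> (A *m d) i 0 = 0) -> 0 < (A *m d) j 0 ->
  exists t : R, [/\ 0 <= t, in_polyhedron A l (u + t *: d) &
                 tight A l u \proper tight A l (u + t *: d)].
Proof.
move=> uP du dj; pose ratio i := (l - (A *m u) i 0) / (A *m d) i 0.
case: (Order.TotalTheory.arg_minP (P := fun i => 0 < (A *m d) i 0) ratio dj) => k dk kmin.
have AE i : (A *m (u + ratio k *: d)) i 0 = (A *m u) i 0 + ratio k * (A *m d) i 0.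
  by rewrite mulmxDr -scalemxAr mxE [X in _ + X]mxE.
have r0 : 0 <= ratio k by rewrite divr_ge0 ?subr_ge0 ?uP // ltW.
exists (ratio k); split=> //.
  move=> i; rewrite AE; have [di|di] := ltP 0 ((A *m d) i 0).
    by rewrite addrC -lerBrDr -ler_pdivlMr // kmin.
  rewrite -[leRHS]addr0 lerD ?uP // mulr_ge0_le0 //.
apply/properP; split.
  apply/subsetP => i ti; rewrite inE AE du // mulr0 addr0.
  by move: ti; rewrite inE.
exists k; first by rewrite inE AE /ratio (divfK (lt0r_neq0 dk)) addrC subrK.
by apply: contraTN dk => /du ->; rewrite ltxx.
Qed.

(** Away from a vertex some direction moves no tight row but changes [A *m u]. Oriented so as not to
    raise the objective, it meets a blocking row because every recession direction lies in [ker A],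
    and the active set grows. *)
Lemma vertex_descent (R : realType) (m n : nat) (A : 'M[R]_(m, n)) (l : R)
    (c : 'rV[R]_m) :
  (forall d : 'cV_n, (forall i, (A *m d) i 0 <= 0) -> A *m d = 0) ->
  forall u, in_polyhedron A l u ->
  exists v, [/\ is_vertex A l v, tight A l u \subset tight A l v &
               (c *m A *m v) 0 0 <= (c *m A *m u) 0 0].
Proof.
move=> bounded u; have [k] := ubnP #|~: tight A l u|.
elim: k u => // k IH u lek uP.
have [vu|nvu] := pselect (is_vertex A l u); first by exists u.
have [d du Ad0] : exists2 d : 'cV_n,
    (forall i, i \in tight A l u -> (A *m d) i 0 = 0) & A *m d != 0.
  apply: contrapT => none; apply: nvu; split=> // d du.
  by apply: contrapT => /eqP Ad; apply: none; exists d.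
wlog cd : d du Ad0 / (c *m A *m d) 0 0 <= 0.
  move=> H; have [|/ltW cd] := leP ((c *m A *m d) 0 0) 0; first exact: H.
  apply: (H (- d)); rewrite ?mulmxN ?oppr_eq0 //.
    by move=> i iu; rewrite mxE du ?oppr0.
  by rewrite mxE oppr_le0.
have [j dj] : exists j, 0 < (A *m d) j 0.
  apply: contrapT => none; move/eqP: Ad0; apply; apply: bounded => i.
  by rewrite leNgt; apply/negP => di; apply: none; exists i.
have [t [t0 tP tu]] := polyhedron_ratio_test uP du dj.
have [|v [vv tv cv]] := IH (u + t *: d) _ tP.
  rewrite -ltnS; apply: leq_trans lek; rewrite ltnS; apply: proper_card.
  by rewrite properC.
exists v; split=> //; first exact: subset_trans (proper_sub tu) tv.
apply: (le_trans cv).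
rewrite mulmxDr -scalemxAr mxE [X in _ + X]mxE gerDl.
exact: mulr_ge0_le0.
Qed.

(** Subtracting [B *m a] from [w - v] kills every row tight at [v], hence lands in [ker A] by the
    vertex property. The objective thus becomes a combination of the slacks of those rows. *)
Lemma vertex_expansion (R : realType) (m n : nat) (A : 'M[R]_(m, n)) (l : R)
    (B : 'M[R]_(n, m)) (c : 'rV[R]_m) (v w : 'cV[R]_n) :
  is_vertex A l v ->
  (forall i j, i \in tight A l v -> j \in tight A l v ->
     (A *m B) i j = (i == j)%:R) ->
  (c *m A *m w) 0 0 - (c *m A *m v) 0 0 =
    \sum_(j in tight A l v) (c *m A *m B) 0 j * ((A *m w) j 0 - l).
Proof.
move=> [_ vv] AB; set E := tight A l v in vv AB *.
pose a : 'cV_m := \col_j (if j \in E then (A *m w) j 0 - l else 0).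
have ABa (M : 'rV[R]_m) i : (M *m a) i 0 =
    \sum_(j in E) M i j * ((A *m w) j 0 - l).
  rewrite mxE [RHS]big_mkcond; apply: eq_bigr => j _; rewrite mxE.
  by case: ifP; rewrite ?mulr0.
have Ad : A *m (w - v - B *m a) = 0.
  apply: vv => i iE; rewrite !mulmxBr mulmxA.
  rewrite [LHS]mxE [X in X + _]mxE [X in _ + X + _]mxE [X in _ + X]mxE.
  have -> : (A *m B *m a) i 0 = (A *m w) i 0 - l.
    rewrite -[LHS](_ : (row i (A *m B) *m a) 0 0 = _); last first.
      by rewrite -row_mul mxE.
    rewrite ABa (bigD1 i) //= mxE AB // eqxx mul1r big1 ?addr0 //.
    by move=> j /andP[jE ji]; rewrite mxE AB // eq_sym (negbTE ji) mul0r.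
  move: iE; rewrite inE => /eqP ->; lra.
rewrite -ABa -mulmxA -[in RHS]mulmxA -[in RHS]mulmxA.
have -> : A *m (B *m a) = A *m w - A *m v.
  by move/eqP: Ad; rewrite !mulmxBr subr_eq0 => /eqP.
by rewrite mulmxBr -!mulmxA !mxE.
Qed.

Lemma mulmx_col (R : realType) (m n q : nat) (A : 'M[R]_(m, n))
    (B : 'M[R]_(n, q)) (j : 'I_q) : A *m col j B = col j (A *m B).
Proof. by rewrite !colE mulmxA. Qed.

(** If [j] were outside [S], a small step along [- col j B] would relax row [j] only among the tight
    rows, stay on the face of [S] and lower the objective. *)
Lemma minimal_vertex_coords (R : realType) (m n : nat) (A : 'M[R]_(m, n))
    (l : R) (B : 'M[R]_(n, m)) (c : 'rV[R]_m) (S : {set 'I_m})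
    (v : 'cV[R]_n) :
  is_vertex A l v -> S \subset tight A l v ->
  (forall w, in_polyhedron A l w -> S \subset tight A l w ->
     (c *m A *m v) 0 0 <= (c *m A *m w) 0 0) ->
  (forall i j, i \in tight A l v -> j \in tight A l v ->
     (A *m B) i j = (i == j)%:R) ->
  forall j, j \in tight A l v -> 0 < (c *m A *m B) 0 j -> j \in S.
Proof.
move=> [vP _] Sv vmin AB j jE cj; apply: contraT => jS.
have AB' i : i \in tight A l v -> (A *m - col j B) i 0 = - (i == j)%:R.
  by move=> iE; rewrite mulmxN mxE mulmx_col mxE AB.
have [|t t0 tP] := polyhedron_small_step (d := - col j B) vP.
  by move=> i /AB' ->; rewrite oppr_le0 ler0n.
have St : S \subset tight A l (v + t *: - col j B).
  apply/subsetP => i iS; have iE := subsetP Sv i iS.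
  rewrite inE mulmxDr -scalemxAr mxE [X in _ + X]mxE AB' //.
  have -> : (i == j) = false by apply: contraNF jS => /eqP <-.
  by rewrite oppr0 mulr0 addr0; move: iE; rewrite inE.
have := vmin _ tP St.
rewrite mulmxDr -scalemxAr [X in _ <= X]mxE [X in _ + X]mxE lerDl mulmxN mulmx_col.
by rewrite [X in _ * X]mxE [X in - X]mxE pmulr_rge0 // oppr_ge0 leNgt cj.
Qed.

(** Both vertices minimize the objective on the face of [S], and genericity lets a minimizer be
    reached only where all tight rows stay tight. *)
Lemma vertex_interval_inj (R : realType) (m n : nat) (A : 'M[R]_(m, n))
    (l : R) (c : 'rV[R]_m) (v v' : 'cV[R]_n) (B B' : 'M[R]_(n, m))
    (S : {set 'I_m}) :
  is_vertex A l v -> is_vertex A l v' ->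
  (forall i j, i \in tight A l v -> j \in tight A l v ->
     (A *m B) i j = (i == j)%:R) ->
  (forall i j, i \in tight A l v' -> j \in tight A l v' ->
     (A *m B') i j = (i == j)%:R) ->
  (forall j, j \in tight A l v -> (c *m A *m B) 0 j != 0) ->
  (forall j, j \in tight A l v' -> (c *m A *m B') 0 j != 0) ->
  S \subset tight A l v -> S \subset tight A l v' ->
  (forall j, j \in tight A l v -> 0 < (c *m A *m B) 0 j -> j \in S) ->
  (forall j, j \in tight A l v' -> 0 < (c *m A *m B') 0 j -> j \in S) ->
  tight A l v = tight A l v'.
Proof.
(* Each term of the expansion at [u] is nonnegative: for [j] in [S] the slack vanishes, otherwise a
   negative coefficient meets a nonpositive factor. Exchanging the two vertices then forces equality
   in both directions. *)
have key (u u' : 'cV[R]_n) (C : 'M[R]_(n, m)) :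
    is_vertex A l u -> in_polyhedron A l u' ->
    (forall i j, i \in tight A l u -> j \in tight A l u ->
       (A *m C) i j = (i == j)%:R) ->
    (forall j, j \in tight A l u -> (c *m A *m C) 0 j != 0) ->
    S \subset tight A l u' ->
    (forall j, j \in tight A l u -> 0 < (c *m A *m C) 0 j -> j \in S) ->
    0 <= (c *m A *m u') 0 0 - (c *m A *m u) 0 0 ?= iff
      (tight A l u \subset tight A l u').
  move=> uV u'P dualC c0 Su' posS; rewrite (vertex_expansion _ _ uV dualC).
  have sum0 : \sum_(j in tight A l u) 0 = 0 :> R by rewrite big1.
  rewrite -[X in X <= _ ?= iff _]sum0.
  have -> : (tight A l u \subset tight A l u') =
      [forall (j | j \in tight A l u), j \in tight A l u'].
    by apply/subsetP/forallP => H j; [apply/implyP; exact: H | exact/implyP].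
  apply: leif_sum => j jE; apply/leifP.
  case: ifP => [|jE']; first by rewrite inE => /eqP ->; rewrite subrr mulr0.
  have cj : (c *m A *m C) 0 j < 0.
    rewrite lt_neqAle c0 // leNgt; apply/negP => /(posS _ jE) jS.
    by rewrite (subsetP Su') in jE'.
  rewrite nmulr_lgt0 // subr_lt0 lt_neqAle u'P andbT.
  by move: jE'; rewrite inE => ->.
move=> vV v'V AB AB' c0 c0' Sv Sv' pos pos'.
have [le1 eq1] := key v v' B vV v'V.1 AB c0 Sv' pos.
have [le2 eq2] := key v' v B' v'V vV.1 AB' c0' Sv pos'.
apply/eqP; rewrite eqEsubset -eq1 -eq2; lra.
Qed.

Lemma card_simple_polyhedron_faces (R : realType) (m n : nat)
    (A : 'M[R]_(m, n)) (l : R) (F : {set {set 'I_m}}) :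
  (forall d : 'cV_n, (forall i, (A *m d) i 0 <= 0) -> A *m d = 0) ->
  (forall u, in_polyhedron A l u -> rows_independent A (tight A l u)) ->
  (forall S, S \in F <-> exists2 u, in_polyhedron A l u & S \subset tight A l u) ->
  (#|F| <= 2 ^ (uphalf n).+1 * #|[set S in F | #|S| <= n./2]%N|)%N.
Proof.
move=> bounded simple FE.
pose isV (E : {set 'I_m}) := exists2 v, is_vertex A l v & tight A l v = E.
pose V := [set E | `[< isV E >]]%SET.
have VP E : reflect (isV E) (E \in V) by rewrite inE; exact: asboolP.
(* One representative vertex per active set; the default 0 is used only outside [V]. *)
have [pt ptP] : {pt : {set 'I_m} -> 'cV[R]_n & forall E, E \in V ->
    is_vertex A l (pt E) /\ tight A l (pt E) = E}.
  apply: (@choice _ _ (fun E v => E \in V -> is_vertex A l v /\ tight A l v = E)) => E.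
  by have [/VP[v ? ?]|nE] := boolP (E \in V); [exists v|exists 0].
have [B BP] : {B : {set 'I_m} -> 'M[R]_(n, m) & forall E, E \in V ->
    forall i j, i \in E -> j \in E -> (A *m B E) i j = (i == j)%:R}.
  apply: (@choice _ _ (fun E M => E \in V ->
    forall i j, i \in E -> j \in E -> (A *m M) i j = (i == j)%:R)) => E.
  have [/ptP[ptV ptE]|nE] := boolP (E \in V); last by exists 0.
  have /rows_independent_dual[M MP] := simple _ ptV.1.
  by exists M => _; rewrite -ptE.
have [c cP] : exists c : 'rV[R]_m, forall E j, E \in V -> j \in E ->
    (c *m A *m B E) 0 j != 0.
  pose g (q : {set 'I_m} * 'I_m) := col q.2 (A *m B q.1).
  have [|c cP] := @generic_functional R m _
      (fun q : {set 'I_m} * 'I_m => (q.1 \in V) && (q.2 \in q.1)) g.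
    move=> [E j] /= /andP[EV jE]; apply/eqP => /matrixP/(_ j 0)/eqP.
    by rewrite /g /= mxE BP // mxE eqxx oner_eq0.
  exists c => E j EV jE; have := cP (E, j); rewrite /g /= EV jE => /(_ isT).
  by rewrite mulmx_col mxE mulmxA.
pose side (x : 'rV[R]_m) (E : {set 'I_m}) := [set j in E | 0 < (x *m A *m B E) 0 j]%SET.
have side_inj (x : 'rV[R]_m) : (forall E j, E \in V -> j \in E ->
      (x *m A *m B E) 0 j != 0) ->
    forall E E' S : {set 'I_m}, E \in V -> E' \in V ->
    side x E \subset S -> S \subset E ->
    side x E' \subset S -> S \subset E' -> E = E'.
  move=> x0 E E' S EV E'V sE SE sE' SE'.
  have [ptV ptE] := ptP _ EV; have [ptV' ptE'] := ptP _ E'V.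
  rewrite -ptE -ptE'.
  apply: (@vertex_interval_inj R m n A l x (pt E) (pt E') (B E) (B E') S) => //;
    rewrite ?ptE ?ptE' //; do ?[exact: BP | by move=> j; exact: x0].
  - by move=> j jE xj; apply: (subsetP sE); rewrite inE jE.
  - by move=> j jE xj; apply: (subsetP sE'); rewrite inE jE.
have oppE E j : (- c *m A *m B E) 0 j = - (c *m A *m B E) 0 j.
  by rewrite !mulNmx mxE.
apply: (@card_two_sided_partition _ F V (side c) (side (- c))) => //.
- move=> E EV; rewrite -setI_eq0; apply/eqP/setP => j; rewrite !inE.
  rewrite oppE oppr_gt0; apply/negbTE.
  by case: ltgtP; rewrite ?andbF.
- move=> E EV; apply/setP => j; rewrite !inE -andb_orr.
  case: (boolP (j \in E)) => //= jE; rewrite oppE oppr_gt0.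
  by rewrite orbC -neq_lt cP.
- move=> E /ptP[ptV <-]; apply: rows_independent_card; exact: simple ptV.1.
- move=> E S /ptP[ptV ptE] SE; apply/FE; exists (pt E); first exact: ptV.1.
  by rewrite ptE.
- move=> S /FE[u uP Su].
  (* The zero functional serves here: only some vertex on the face of [S] is wanted, to start the
     minimization over [V]. *)
  have [v [vV uv _]] := vertex_descent 0 bounded uP.
  pose val E := (c *m A *m pt E) 0 0.
  have v0V : (tight A l v \in V) && (S \subset tight A l v).
    by rewrite (subset_trans Su uv) andbT; apply/VP; exists v.
  case: (Order.TotalTheory.arg_minP (P := fun E => (E \in V) && (S \subset E)) val v0V).
  move=> E /andP[EV SE] Emin; exists E => //; rewrite SE andbT.
  have [ptV ptE] := ptP _ EV.
  apply/subsetP => j; rewrite inE => /andP[jE cj].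
  apply: (@minimal_vertex_coords R m n A l (B E) c S (pt E)) => //;
    rewrite ?ptE //; last exact: BP.
  move=> w wP Sw; have [z [zV wz cz]] := vertex_descent c bounded wP.
  apply: le_trans cz.
  have zT : tight A l z \in V by apply/VP; exists z.
  have [ptV' ptE'] := ptP _ zT.
  apply: (@le_trans _ _ (val (tight A l z))).
    by apply: Emin; rewrite zT (subset_trans Sw wz).
  (* The vertex [z] and the representative of its active set may differ, but only by an element of
     [ker A], which the objective does not see. *)
  rewrite /val; set z' := pt _ in ptV' ptE' *.
  have /zV.2 Azz : forall i, i \in tight A l z -> (A *m (z' - z)) i 0 = 0.
    move=> i iz; have : i \in tight A l z' by rewrite ptE'.
    move: iz; rewrite mulmxBr !inE => /eqP iz /eqP iz'.
    by rewrite mxE [X in _ + X]mxE iz iz' subrr.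
  move: Azz; rewrite mulmxBr => /eqP; rewrite subr_eq0 => /eqP Azz.
  by rewrite -!mulmxA Azz.
- exact: side_inj.
- apply: side_inj => E j EV jE; rewrite oppE oppr_eq0; exact: cP.
Qed.

(* [setT] must again be the classical one, as in Defs. *)
Import classical_sets.

(** * Optimality conditions of the signed lasso *)

Lemma norm2_sqr (R : realType) (m : nat) (v : 'cV[R]_m) :
  norm2 v ^+ 2 = \sum_j v j 0 ^+ 2.
Proof. by rewrite sqr_sqrtr // sumr_ge0 // => j _; exact: sqr_ge0. Qed.

Lemma dot_mulmx (R : realType) (m n : nat) (X : 'M[R]_(m, n))
    (u : 'cV[R]_m) (d : 'cV[R]_n) :
  \sum_j d j 0 * (X^T *m u) j 0 = \sum_i u i 0 * (X *m d) i 0.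
Proof.
rewrite [RHS](eq_bigr (fun i => \sum_j d j 0 * (X i j * u i 0))); last first.
  by move=> i _; rewrite mxE big_distrr /=; apply: eq_bigr => j _; ring.
rewrite exchange_big /=; apply: eq_bigr => j _; rewrite mxE big_distrr /=.
by apply: eq_bigr => i _; rewrite mxE.
Qed.

(** The exact Taylor formula of a quadratic: the middle sum pairs [d] with the gradient at [b], and
    both directions of KKT are read off it. *)
Lemma signed_lasso_expand (R : realType) (n p : nat) (X0 : 'M[R]_(n, p))
    (l : R) (y : 'cV[R]_n) (b d : 'cV[R]_(p + p)) :
  let X := signed_design X0 in
  signed_lasso X0 l y (b + d) = signed_lasso X0 l y b +
    \sum_j d j 0 * (l - (X^T *m (y - X *m b)) j 0) +
    2^-1 * norm2 (X *m d) ^+ 2.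
Proof.
move=> X; rewrite /signed_lasso -/X !norm2_sqr mulmxDr opprD addrA.
set u := y - X *m b.
have cross : \sum_j d j 0 * (X^T *m u) j 0 = \sum_i u i 0 * (X *m d) i 0.
  exact: dot_mulmx.
have -> : \sum_j (u - X *m d) j 0 ^+ 2 = \sum_j u j 0 ^+ 2 -
    2 * (\sum_j u j 0 * (X *m d) j 0) + \sum_j (X *m d) j 0 ^+ 2.
  rewrite big_distrr /= -sumrB -big_split /=; apply: eq_bigr => j _.
  by rewrite mxE [X in _ + X]mxE; ring.
have -> : \sum_j (b + d) j 0 = \sum_j b j 0 + \sum_j d j 0.
  by rewrite -big_split /=; apply: eq_bigr => j _; rewrite mxE.
have -> : \sum_j d j 0 * (l - (X^T *m u) j 0) =
    l * (\sum_j d j 0) - \sum_j d j 0 * (X^T *m u) j 0.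
  by rewrite big_distrr -sumrB /=; apply: eq_bigr => j _; ring.
by rewrite cross; field.
Qed.

Lemma kkt_necessary (R : realType) (n p : nat) (X0 : 'M[R]_(n, p))
    (l : R) (y : 'cV[R]_n) (b : 'cV[R]_(p + p)) :
  let X := signed_design X0 in
  minimizer (@nneg_vec R (p + p)) (signed_lasso X0 l y) b ->
  in_polyhedron X^T l (y - X *m b) /\ supp b \subset tight X^T l (y - X *m b).
Proof.
move=> X [b0 bmin]; set u := y - X *m b.
pose q j := norm2 (X *m delta_mx j 0) ^+ 2.
have q0 j : 0 <= q j by exact: sqr_ge0.
have step j t : 0 <= b j 0 + t ->
    0 <= t * (l - (X^T *m u) j 0 + 2^-1 * t * q j).
  have dE k : (t *: delta_mx j 0 : 'cV[R]_(p + p)) k 0 = t * (k == j)%:R.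
    by rewrite !mxE eqxx andbT.
  move=> bt; have := bmin (b + t *: delta_mx j 0).
  rewrite signed_lasso_expand -/X -/u -addrA lerDl.
  have -> : \sum_k (t *: delta_mx j 0 : 'cV_(p + p)) k 0 * (l - (X^T *m u) k 0) =
      t * (l - (X^T *m u) j 0).
    rewrite (bigD1 j) //= dE eqxx mulr1 big1 ?addr0 // => k kj.
    by rewrite dE (negbTE kj) mulr0 mul0r.
  have -> : norm2 (X *m (t *: delta_mx j 0)) ^+ 2 = t ^+ 2 * q j.
    rewrite /q !norm2_sqr big_distrr /=; apply: eq_bigr => i _.
    by rewrite -scalemxAr mxE exprMn.
  rewrite (_ : t * _ + _ = t * (l - (X^T *m u) j 0 + 2^-1 * t * q j)); last by ring.
  apply=> k; rewrite mxE dE.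
  by have [->|_] := eqVneq k j; rewrite ?mulr1 // mulr0 addr0.
have uP : in_polyhedron X^T l u.
  move=> j; rewrite leNgt; apply/negP => gt; have qj := q0 j.
  (* This step keeps the quadratic term below the linear gain; the added 1 guards against
     [q j = 0]. *)
  pose t := ((X^T *m u) j 0 - l) / (1 + q j).
  have t0 : 0 < t by rewrite divr_gt0 ?subr_gt0 // ltr_pwDl.
  have tE : t * (1 + q j) = (X^T *m u) j 0 - l by rewrite divfK // gt_eqF // ltr_pwDl.
  have tq : 0 <= t * q j by rewrite mulr_ge0 // ltW.
  have := step j t; rewrite pmulr_rge0 // addr_ge0 ?(ltW t0) ?b0 // => /(_ isT).
  by move: tE; rewrite mulrDr mulr1 -mulrA; lra.
split=> //; apply/fintype.subsetP => j; rewrite !inE => bj.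
rewrite eq_le uP leNgt; apply/negP => lt; have qj := q0 j.
pose r := (l - (X^T *m u) j 0) / (1 + q j).
have r0 : 0 < r by rewrite divr_gt0 ?subr_gt0 // ltr_pwDl.
have rE : r * (1 + q j) = l - (X^T *m u) j 0 by rewrite divfK // gt_eqF // ltr_pwDl.
(* Here coordinate [j] is decreased, so the step is capped to keep it nonnegative. *)
pose t := Num.min (b j 0) r.
have t0 : 0 < t by rewrite lt_min bj.
have tr : t <= r by rewrite ge_min lexx orbT.
have tb : t <= b j 0 by rewrite ge_min lexx.
have tq : 0 <= t * q j by rewrite mulr_ge0 // ltW.
have trq : t * (1 + q j) <= r * (1 + q j) by rewrite ler_wpM2r // addr_ge0.
have := step j (- t); rewrite subr_ge0 => /(_ tb).
rewrite mulNr oppr_ge0 pmulr_rle0 //.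
by move: trq; rewrite rE mulrDr mulr1 mulrN mulNr -mulrA; lra.
Qed.

(** The response is built so that [u] is the residual at [b]. In the expansion, tight coordinates
    have zero gradient; on the others [b] vanishes, so both the increment and the gradient are
    nonnegative. *)
Lemma kkt_sufficient (R : realType) (n p : nat) (X0 : 'M[R]_(n, p))
    (l : R) (u : 'cV[R]_n) (b : 'cV[R]_(p + p)) :
  let X := signed_design X0 in
  in_polyhedron X^T l u -> nneg_vec b ->
  (forall j, j \notin tight X^T l u -> b j 0 = 0) ->
  minimizer (@nneg_vec R (p + p)) (signed_lasso X0 l (u + X *m b)) b.
Proof.
move=> X uP b0 bE; split=> // z z0.
rewrite -[z](subrK b) [z - b + b]addrC signed_lasso_expand -/X addrK -addrA lerDl.
apply: addr_ge0; last by rewrite mulr_ge0 ?sqr_ge0.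
apply: sumr_ge0 => j _.
have [|jE] := boolP (j \in tight X^T l u).
  by rewrite inE => /eqP ->; rewrite subrr mulr0.
by rewrite mulr_ge0 ?subr_ge0 ?uP // mxE [X in _ + X]mxE bE // oppr0 addr0.
Qed.

(** * The dual polyhedron of the lasso and the final count *)

(** A relation [w] among active columns perturbs a solution supported on the whole active set
    without changing the fit. Both vectors satisfy KKT for the same response, so uniqueness forces
    [w = 0]. *)
Lemma unique_rows_independent (R : realType) (n p : nat) (X0 : 'M[R]_(n, p))
    (l : R) : 0 < l ->
  let X := signed_design X0 in
  (forall y : 'cV[R]_n, exists! b0 : 'cV[R]_p, minimizer setT (lasso X0 l y) b0) ->
  forall u, in_polyhedron X^T l u -> rows_independent X^T (tight X^T l u).
Proof.
move=> l0 X uniq u uP w wE wX.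
(* Scaling by [K^-1] makes the entries of [w] at most 1 in absolute value, so [b'] stays
   nonnegative. *)
pose K := 1 + \sum_j `|w 0 j|.
have K0 : 0 < K by rewrite ltr_pwDl // sumr_ge0.
pose b : 'cV[R]_(p + p) := \col_j (j \in tight X^T l u)%:R.
pose b' := b + K^-1 *: w^T.
have XwT : X *m w^T = 0 by rewrite -[X]trmxK -trmx_mul wX trmx0.
have Xb' : X *m b' = X *m b by rewrite mulmxDr -scalemxAr XwT scaler0 addr0.
have minb : minimizer (@nneg_vec R (p + p)) (signed_lasso X0 l (u + X *m b)) b.
  apply: kkt_sufficient => // [j|j jE]; rewrite mxE ?ler0n //.
  by rewrite (negbTE jE).
have minb' : minimizer (@nneg_vec R (p + p)) (signed_lasso X0 l (u + X *m b)) b'.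
  rewrite -Xb'; apply: kkt_sufficient => // [j|j jE]; rewrite !mxE.
    have [jE|jE] := boolP (j \in tight X^T l u); last by rewrite wE // mulr0 addr0.
    have : `|w 0 j| / K <= 1.
      rewrite ler_pdivrMr // mul1r /K (bigD1 j) //= addrCA lerDl.
      by rewrite addr_ge0 // sumr_ge0.
    have : - w 0 j / K <= `|w 0 j| / K.
      by apply: ler_wpM2r; [rewrite invr_ge0 ltW | rewrite -normrN ler_norm].
    by rewrite mulNr [K^-1 * _]mulrC /=; lra.
  by rewrite (negbTE jE) wE // mulr0 addr0.
have [b0 [_ b0u]] := signed_lasso_unique l0 (uniq (u + X *m b)).
have : b' = b by rewrite -(b0u _ minb) (b0u _ minb').
rewrite /b' => /eqP; rewrite -subr_eq0 addrAC subrr add0r scaler_eq0.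
rewrite invr_eq0 gt_eqF //= => /eqP wT; by rewrite -[w]trmxK wT trmx0.
Qed.

(** Rows come in opposite pairs, so a recession direction satisfies each inequality with both
    signs. *)
Lemma signed_design_bounded (R : realType) (n p : nat) (X0 : 'M[R]_(n, p))
    (d : 'cV[R]_n) :
  (forall i, ((signed_design X0)^T *m d) i 0 <= 0) -> (signed_design X0)^T *m d = 0.
Proof.
rewrite /signed_design tr_row_mx mul_col_mx linearN /= mulNmx => neg.
suff -> : X0^T *m d = 0 by rewrite oppr0 col_mx0.
apply/matrixP => j k; rewrite (ord1 k) [RHS]mxE; apply/eqP; rewrite eq_le.
have := neg (lshift p j); have := neg (rshift p j).
rewrite col_mxEu col_mxEd [X in X <= 0]mxE oppr_le0.
by move=> ->->.
Qed.

Lemma tight_antipode_free (R : realType) (n p : nat) (X0 : 'M[R]_(n, p))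
    (l : R) (u : 'cV[R]_n) (j : 'I_p) : 0 < l ->
  ~~ ((lshift p j \in tight (signed_design X0)^T l u) &&
      (rshift p j \in tight (signed_design X0)^T l u)).
Proof.
move=> l0; rewrite !inE /signed_design tr_row_mx mul_col_mx linearN /= mulNmx.
rewrite col_mxEu col_mxEd [X in _ && (X == _)]mxE.
by apply/negP => /andP[/eqP -> /eqP]; lra.
Qed.

Lemma accessible_tight (R : realType) (n p : nat) (X0 : 'M[R]_(n, p)) (l : R)
    (S : {set 'I_(p + p)}) : 0 < l ->
  (forall y : 'cV[R]_n, exists! b0 : 'cV[R]_p, minimizer setT (lasso X0 l y) b0) ->
  accessible X0 l S ->
  exists2 u, in_polyhedron (signed_design X0)^T l u &
    S \subset tight (signed_design X0)^T l u.
Proof.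
move=> l0 uniq [y <-].
have [b [bmin _]] := signed_lasso_unique l0 (uniq y).
have /kkt_necessary[uP Su] : minimizer (@nneg_vec R (p + p))
    (signed_lasso X0 l y) (signed_sol X0 l y).
  exact: (xgetPex 0 (ex_intro _ b bmin)).
(* The dual point is the lasso residual. *)
by exists (y - signed_design X0 *m signed_sol X0 l y).
Qed.
Theorem corollary3p1 (R : realType) (n p : nat) (X0 : 'M[R]_(n, p))
    (lambda : R) (hn : (1 <= n)%N) (hp : (1 <= p)%N) (hlambda : 0 < lambda)
    (huniq : forall y : 'cV[R]_n,
       exists! b0 : 'cV[R]_p, minimizer setT (lasso X0 lambda y) b0)
    (hpn : (n <= p)%N) :
  #|accessible_models X0 lambda|%:R <=
    2 * expR 1 * (n%:R + 1) *
    (2 * expR 1 * (2 * p%:R - (n./2)%:R) / (uphalf n)%:R) ^+ n./2 :> R.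
Proof.
pose A := (signed_design X0)^T.
(* All subsets of active sets are counted, since the interval argument wants a family closed under
   subsets. *)
pose face (S : {set 'I_(p + p)}) :=
  exists2 u, in_polyhedron A lambda u & S \subset tight A lambda u.
pose F := [set S | `[< face S >]]%SET.
have FE S : S \in F <-> face S by rewrite inE; split => /asboolP.
have accF : (#|accessible_models X0 lambda| <= #|F|)%N.
  apply: subset_leq_card; apply/fintype.subsetP => S; rewrite inE => /asboolP.
  by move=> /(accessible_tight hlambda huniq)/FE.
have faceF := card_simple_polyhedron_faces (@signed_design_bounded R n p X0)
  (unique_rows_independent hlambda huniq) FE.
have smallF : (#|[set S in F | #|S| <= n./2]%SET| <=
    \sum_(i < n./2.+1) 2 ^ i * 'C(p, i))%N.
  apply: card_antipode_free => S; rewrite inE => /andP[/FE[u _ /fintype.subsetP Su] //].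
  move=> _ j; have := tight_antipode_free X0 u j hlambda.
  by apply: contra => /andP[/Su -> /Su ->].
apply: le_trans (lasso_numeric_bound R hn hpn); rewrite ler_nat.
apply: leq_trans accF (leq_trans faceF _).
by rewrite leq_mul2l smallF orbT.
Qed.
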